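(* Let $d\ge 1$ be an integer and let $Q_d$ be the $d$-dimensional hypercube graph. In the $(1:1)$ Maker-Breaker degree game played on $Q_d$, Breaker has a strategy to secure a degree of at least $\lfloor d/3\rfloor$ at every vertex; that is, $\delta_B(Q_d)\ge \lfloor d/3\rfloor$.
   Context: The hypercube graph $Q_d$ has vertex set $\{0,1\}^d$, two vertices being adjacent when they differ in exactly one coordinate. Degree game. Given a graph $G$, two players, Maker and Breaker, alternately claim previously unclaimed edges of $G$, one edge per turn, with Maker moving first, until all edges are claimed. For a nonnegative integer $t$, Breaker secures degree $t$ at every vertex if at the end of the game every vertex is incident to at least $t$ edges claimed by Breaker (equivalently, Maker never claims $\deg_G(x)-t+1$ edges at any vertex $x$). $\delta_B(G)$ denotes the largest $t$ for which Breaker has a strategy that, whatever Maker does, secures degree $t$ at every vertex. *)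

(* Defs.v *)
From mathcomp Require Import all_boot.
From mathcomp Require Import boolp.

Set Implicit Arguments.
Unset Strict Implicit.
Unset Printing Implicit Defensive.

(* A graph is an adjacency relation on a finite type (meant to be symmetric
   and irreflexive); its edges are the pairs {x, y} of adjacent vertices. *)
Definition edges (T : finType) (e : rel T) : {set {set T}} :=
  [set [set xy.1; xy.2] | xy in [set xy : T * T | e xy.1 xy.2]].

(* A position is the sequence of the edges claimed so far, in chronological
   order. Maker moves first, so (counting from 0) the edges of even index are
   Maker's, those of odd index are Breaker's, and Breaker is to move exactly
   when the sequence has odd length. *)
Definition position (T : finType) (e : rel T) (h : seq {set T}) : Prop :=
  uniq h /\ {subset h <= edges e}.

Definition complete_play (T : finType) (e : rel T) (p : seq {set T}) : Prop :=
  position e p /\ {subset edges e <= p}.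

Definition strategy (T : finType) := seq {set T} -> {set T}.

(* Without this condition a strategy making illegal moves would be followed by
   no complete play, and would secure every degree vacuously. *)
Definition legal_breaker_strategy (T : finType) (e : rel T) (s : strategy T) :
    Prop :=
  forall h, position e h -> odd (size h) -> ~ complete_play e h ->
    s h \in edges e /\ s h \notin h.

Definition breaker_follows (T : finType) (s : strategy T) (p : seq {set T}) :
    Prop :=
  forall i, i < size p -> odd i -> nth set0 p i = s (take i p).

Definition breaker_degree (T : finType) (p : seq {set T}) (x : T) : nat :=
  #|[set f in p | odd (index f p) & x \in f]|.

Definition breaker_secures (T : finType) (e : rel T) (t : nat) : Prop :=
  exists2 s : strategy T, legal_breaker_strategy e s &
    forall p, complete_play e p -> breaker_follows s p ->
    forall x, t <= breaker_degree p x.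

(* The largest t that Breaker can secure. Bounding t by the number of edges is
   harmless if there is at least one vertex: see leq_deltaB. *)
Definition deltaB (T : finType) (e : rel T) : nat :=
  \max_(t < #|edges e|.+1 | `[< breaker_secures e t >]) t.

Definition hypercube (d : nat) : rel {ffun 'I_d -> bool} :=
  fun u v => #|[set i | u i != v i]| == 1.

Lemma hypercube_sym d : symmetric (@hypercube d).
Proof.
move=> u v; rewrite /hypercube; congr (#|pred_of_set _| == 1).
by apply/setP=> i; rewrite !inE eq_sym.
Qed.

Lemma hypercube_irr d : irreflexive (@hypercube d).
Proof.
move=> u; rewrite /hypercube (_ : [set i | _] = set0) ?cards0 //.
by apply/setP=> i; rewrite !inE eqxx.
Qed.

Lemma complete_play_exists (T : finType) (e : rel T) (s : strategy T) :
  legal_breaker_strategy e s ->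
  exists2 p, complete_play e p & breaker_follows s p.
Proof.
move=> sL.
suff ext n h : #|edges e| - size h <= n -> position e h ->
    breaker_follows s h -> exists2 p, complete_play e p & breaker_follows s p.
  by apply: (ext _ [::] (leqnn _)) => //; split.
elim: n h => [|n IH] h.
  rewrite leqn0 subn_eq0 => le_h [uh sh] fh; exists h => //; split=> //.
  have sub : h \subset edges e by apply/subsetP.
  have /subset_cardP/(_ sub) eqh : #|h| = #|edges e|.
    by apply/eqP; rewrite eqn_leq subset_leq_card //= (card_uniqP uh).
  by move=> f; rewrite eqh.
move=> le_n [uh sh] fh.
have [ch|nch] := pselect (complete_play e h); first by exists h.
have [f [fe fh' fs]] : exists f, [/\ f \in edges e, f \notin h &
    odd (size h) -> f = s h].
  case: (boolP (odd (size h))) => oh.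
    by have [? ?] := sL h (conj uh sh) oh nch; exists (s h).
  case: (pickP [pred f | (f \in edges e) && (f \notin h)]) => [f /andP[? ?]|no].
    by exists f.
  case: nch; split=> // f fe.
  by apply: contraFT (no f) => fh'; rewrite /= fe.
apply: (IH (rcons h f)).
- by rewrite size_rcons subnS -subn1 leq_subLR add1n.
- split; first by rewrite rcons_uniq fh'.
  by move=> g; rewrite mem_rcons inE => /predU1P[->//|/sh].
- move=> i; rewrite size_rcons ltnS leq_eqVlt => /predU1P[->|lti] oi.
    by rewrite nth_rcons ltnn eqxx -cats1 take_size_cat // fs.
  by rewrite nth_rcons lti -cats1 takel_cat 1?ltnW // fh.
Qed.

Lemma leq_deltaB (T : finType) (e : rel T) (x0 : T) (t : nat) :
  breaker_secures e t <-> t <= deltaB e.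
Proof.
split=> [st|].
  have [s sL sT] := st.
  have [p cp fp] := complete_play_exists sL.
  have tE : t < #|edges e|.+1.
    rewrite ltnS (leq_trans (sT p cp fp x0)) // subset_leq_card //.
    by apply/subsetP=> f; rewrite inE => /andP[/(proj2 (proj1 cp))].
  by apply: (bigmax_sup (Ordinal tE)) => //; apply/asboolP.
suff [s sL sT] : breaker_secures e (deltaB e).
  move=> le_t; exists s => // p cp fp x.
  exact: leq_trans le_t (sT p cp fp x).
rewrite /deltaB; elim/big_ind: _ => [|m n sm sn|i /asboolP //].
  pose s : strategy T := fun h => odflt set0 [pick f in edges e | f \notin h].
  exists s => // h ph _ nc; rewrite /s.
  case: pickP => [f /andP[? ?]//|no]; case: nc; split=> // f fe.
  by apply: contraFT (no f) => fh; rewrite /= fe.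
by rewrite /maxn; case: ifP.
Qed.

(* Main.v *)
Require Import Defs.
From mathcomp Require Import all_boot.
From mathcomp Require Import boolp.

(* The edges of Q_d whose direction lies in a given triple of coordinates form
   vertex-disjoint copies of Q_3. Breaker, moving second, can touch every vertex
   of Q_3, so by answering in the copy where Maker just played he gets, at each
   vertex, one edge from each of the d/3 triples. The edges in the at most two
   leftover directions are paired by flipping coordinate 0, so that Breaker
   always has an answer outside the copies of Q_3 when Maker plays there.

   On Q_3 no pairing strategy exists at the start (8 vertices would need 16
   edges), but Breaker can play so that after at most three rounds the free
   edges split into pairs, one at each vertex he has not touched yet. That is
   checked by computation. *)

Set Implicit Arguments.
Unset Strict Implicit.
Unset Printing Implicit Defensive.

(** * From an invariant of positions to a strategy for Breaker *)

Section Invariant.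
Variables (T : finType) (e : rel T).
Implicit Types (p h : seq {set T}) (f m b : {set T}) (M B : {set {set T}}).

Definition maker_edges h : {set {set T}} := [set f in h | ~~ odd (index f h)].
Definition breaker_edges h : {set {set T}} := [set f in h | odd (index f h)].

Lemma edges_split h : maker_edges h :|: breaker_edges h =i h.
Proof. by move=> f; rewrite !inE -andb_orr orNb andbT. Qed.

Lemma maker_edges_rcons h f : f \notin h ->
  maker_edges (rcons h f) =
  if odd (size h) then maker_edges h else f |: maker_edges h.
Proof.
move=> fh; case: ifP => oh; apply/setP=> g; rewrite !inE mem_rcons inE
  -cats1 index_cat /=; case: eqVneq => [->|_] /=.
- by rewrite (negbTE fh) addn0 oh.
- by case: (g \in h).
- by rewrite (negbTE fh) addn0 oh.
- by case: (g \in h).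
Qed.

Lemma breaker_edges_rcons h f : f \notin h ->
  breaker_edges (rcons h f) =
  if odd (size h) then f |: breaker_edges h else breaker_edges h.
Proof.
move=> fh; case: ifP => oh; apply/setP=> g; rewrite !inE mem_rcons inE
  -cats1 index_cat /=; case: eqVneq => [->|_] /=.
- by rewrite (negbTE fh) addn0 oh.
- by case: (g \in h).
- by rewrite (negbTE fh) addn0 oh.
- by case: (g \in h).
Qed.

(** [Inv] speaks of positions with Maker to move. A reply is demanded even to the last free edge, so
    [Inv] can hold only when the number of free edges is even. *)
Definition maintains (Inv : {set {set T}} -> {set {set T}} -> Prop) : Prop :=
  forall M B m, Inv M B -> m \in edges e -> m \notin M :|: B ->
  exists b, [/\ b \in edges e, b \notin m |: (M :|: B) & Inv (m |: M) (b |: B)].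

Lemma invariant_secures (Inv : {set {set T}} -> {set {set T}} -> Prop) t :
  Inv set0 set0 -> maintains Inv ->
  (forall M B, Inv M B -> edges e \subset M :|: B ->
     forall x, t <= #|[set f in B | x \in f]|) ->
  breaker_secures e t.
Proof.
move=> Inv0 InvS Invt.
pose good h b := [&& b \in edges e, b \notin h &
                  `[< Inv (maker_edges h) (b |: breaker_edges h) >]].
(* Legality is required at every position, also where the invariant is already lost; there any free
   edge is played. *)
pose s h := if [pick b | good h b] is Some b then b
            else odflt set0 [pick b in edges e | b \notin h].
exists s => [h ph _ nc|p [[up sp] cp] fp x].
  rewrite /s; case: pickP => [b /and3P[]//|_].
  case: pickP => [b /andP[]//|no]; case: nc; split=> // f fe.
  by apply: contraFT (no f) => fh; rewrite /= fe.
(* One round: Maker's edge has index [i.*2], and Breaker's answer at index [i.*2.+1] restores the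
   invariant. *)
have reply i : i.*2 < size p -> let h := take i.*2 p in
    Inv (maker_edges h) (breaker_edges h) ->
    i.*2.+1 < size p /\ let h' := take i.*2.+2 p in
    Inv (maker_edges h') (breaker_edges h').
  move=> ltip h Ih; pose m := nth set0 p i.*2.
  have sh : size h = i.*2 by rewrite size_takel 1?ltnW.
  have mp : m \in p by apply: mem_nth.
  have uh1 : uniq (rcons h m) by rewrite -take_nth // take_uniq.
  have mh : m \notin h by move: uh1; rewrite rcons_uniq => /andP[].
  have M1 := maker_edges_rcons mh; have B1 := breaker_edges_rcons mh.
  rewrite sh odd_double in M1 B1.
  have mh' : m \notin maker_edges h :|: breaker_edges h by rewrite edges_split.
  have [b [be bh Ib]] := InvS _ _ _ Ih (sp _ mp) mh'.
  have gb : good (rcons h m) b.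
    rewrite /good be mem_rcons inE M1 B1 -edges_split.
    by move: bh; rewrite in_setU1 => -> /=; apply/asboolP.
  (* The edge [b] is still free after Maker's move, so a complete play cannot stop there. *)
  have lt1 : i.*2.+1 < size p.
    rewrite ltnNge; apply/negP=> le1; case/and3P: gb => _ + _.
    by rewrite -take_nth // take_oversize // (cp _ be).
  split=> //=; rewrite (take_nth set0) // fp //=; last by rewrite odd_double.
  rewrite (take_nth set0) // -/h -/m /s.
  case: pickP => [b' /and3P[_ b'h /asboolP]|/(_ b)]; last by rewrite gb.
  rewrite (maker_edges_rcons b'h) (breaker_edges_rcons b'h).
  by rewrite size_rcons sh /= odd_double.
have Inv_take i : i.*2 <= size p ->
    Inv (maker_edges (take i.*2 p)) (breaker_edges (take i.*2 p)).
  elim: i => [_|i IH le_i].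
    have [-> ->//] : maker_edges (take 0 p) = set0 /\
                     breaker_edges (take 0 p) = set0.
    by rewrite take0; split; apply/setP=> f; rewrite !inE.
  have lei : i.*2 < size p by apply: ltnW.
  by have [] := reply i lei (IH (ltnW lei)).
have sz := odd_double_half (size p).
(* Breaker moves last: if Maker did, [reply] would provide one more move. *)
have ev : (size p)./2.*2 = size p.
  rewrite -[RHS]sz; case op: (odd _) sz => // sz.
  have lt : (size p)./2.*2 < size p by rewrite -[X in _ < X]sz add1n.
  have [+ _] := reply _ lt (Inv_take _ (ltnW lt)).
  by rewrite -[X in _ < X]sz add1n ltnn.
have := Inv_take (size p)./2; rewrite ev take_size => /(_ (leqnn _)) Ip.
rewrite (leq_trans (Invt _ _ Ip _ x)) //.
  by apply/subsetP=> f /cp; rewrite edges_split.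
rewrite /breaker_degree subset_leq_card //; apply/subsetP=> f.
by rewrite !inE -andbA.
Qed.

End Invariant.

(** * The game on [Q_3]: pairings and a verified search *)

Definition flip_bit (v : seq bool) (j : nat) : seq bool :=
  set_nth false v j (~~ nth false v j).

Definition cube3_vertices : seq (seq bool) :=
  [seq x :: v | x <- [:: false; true],
     v <- [seq [:: y; z] | y <- [:: false; true], z <- [:: false; true]]].

Definition edge3 : Type := seq bool * seq bool.

(** Only [false] bits are flipped, so each of the 12 edges is listed once, from its lower end. *)
Definition cube3_edges : seq edge3 :=
  [seq (v, flip_bit v j) | v <- cube3_vertices,
     j <- [seq j <- [:: 0; 1; 2] | ~~ nth false v j]].

Definition incident (v : seq bool) (c : edge3) : bool :=
  (v == c.1) || (v == c.2).

Definition unclaimed (M B : seq edge3) : seq edge3 :=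
  [seq c <- cube3_edges | c \notin M ++ B].

(** A winning pairing: Breaker takes the partner of each edge that Maker takes. All free edges are
    paired, so that the partner always exists. *)
Definition pairs_off (M B : seq edge3) (P : seq (edge3 * edge3)) : bool :=
  perm_eq (unclaimed M B) (flatten [seq [:: ab.1; ab.2] | ab <- P]) &&
  all (fun v => has (incident v) B ||
                has (fun ab => incident v ab.1 && incident v ab.2) P)
    cube3_vertices.

(** Maker is to move. Without [~~ nilp] a full board would be safe vacuously, whatever vertices
    Breaker has missed. *)
Inductive safe : seq edge3 -> seq edge3 -> Prop :=
| SafePairs M B P of pairs_off M B P : safe M B
| SafeAnswer M B of ~~ nilp (unclaimed M B) &
    (forall m, m \in unclaimed M B ->
       exists2 b, b \in unclaimed (m :: M) B & safe (m :: M) (b :: B)) :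
    safe M B.

(** In the pairing case Breaker takes the partner of [m], and the other pairs still form a valid
    pairing. *)
Lemma safe_answer M B m : safe M B -> m \in unclaimed M B ->
  exists2 b, b \in unclaimed (m :: M) B & safe (m :: M) (b :: B).
Proof.
move=> sMB; case: sMB m => {M B} M B => [P|_] + m; last exact.
case/andP=> pP aP mF; have := mF; rewrite (perm_mem pP).
have uF : uniq (unclaimed M B) by apply: filter_uniq.
case/flattenP=> _ /mapP[ab abP ->] /= mab.
have [b mb] : exists b, perm_eq [:: ab.1; ab.2] [:: m; b].
  move: mab; rewrite !inE => /orP[] /eqP ->; first by exists ab.2.
  by exists ab.1; rewrite (perm_catC [:: _] [:: _]).
have [P' PP'] : exists P', perm_eq P (ab :: P').
  by exists (rem ab P); apply: perm_to_rem.
have pP' : perm_eq (unclaimed M B)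
                   (m :: b :: flatten [seq [:: ab.1; ab.2] | ab <- P']).
  rewrite (perm_trans pP) //.
  have := perm_flatten (perm_map (fun ab => [:: ab.1; ab.2]) PP').
  move/perm_trans; apply.
  exact: (perm_cat mb (perm_refl _)).
have := uF; rewrite (perm_uniq pP') /= inE negb_or -andbA.
case/and4P=> nmb mQ bQ uQ.
have Fm : unclaimed (m :: M) B = [seq c <- unclaimed M B | c != m].
  rewrite /unclaimed -filter_predI; apply: eq_filter => c /=.
  by rewrite inE negb_or.
have Fmb : unclaimed (m :: M) (b :: B) =
           [seq c <- unclaimed M B | (c != m) && (c != b)].
  rewrite /unclaimed -filter_predI; apply: eq_filter => c /=.
  by rewrite !(inE, mem_cat) !negb_or; do ![case: (_ == _) | case: (_ \in _)].
exists b.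
  rewrite Fm mem_filter eq_sym nmb (perm_mem pP') !inE eqxx orbT //.
apply: (@SafePairs _ _ P'); apply/andP; split.
  rewrite Fmb (perm_trans (perm_filter _ pP')) //=.
  rewrite eqxx /= (eq_sym b) nmb /= eqxx /=.
  rewrite (_ : filter _ _ = flatten [seq [:: ab.1; ab.2] | ab <- P']) //.
  apply/all_filterP/allP=> c cQ.
  by rewrite (memPn mQ _ cQ) (memPn bQ _ cQ).
apply/allP=> v /(allP aP) /orP[hB|hP]; first by rewrite /= hB orbT.
move: hP; rewrite (perm_has _ PP') /= => /orP[hab|->]; last by rewrite orbT.
(* A vertex served by the removed pair is an end of both its edges, so [b] touches it. *)
have : all (incident v) [:: ab.1; ab.2] by rewrite /= andbT.
by rewrite (perm_all _ mb) /= => /and3P[_ -> _].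
Qed.

Lemma safe_end M B v : safe M B -> unclaimed M B = [::] ->
  v \in cube3_vertices -> has (incident v) B.
Proof.
case=> {M B} M B => [P /andP[pP aP]|+ _] F0 vV; last by rewrite F0.
case/orP: (allP aP v vV) => // /hasP[ab abP _].
have := perm_size pP; rewrite F0 size_flatten /shape -map_comp /=.
by case: P abP {pP aP}.
Qed.

(** For the edges that remain once every untouched vertex has its pair. An odd last edge is dropped,
    and [pairs_off] then rejects the pairing. *)
Fixpoint pair_up (F : seq edge3) : seq (edge3 * edge3) :=
  if F is a :: b :: F' then (a, b) :: pair_up F' else [::].

(* The result is only a candidate, to be checked by [pairs_off]. The test on
   sizes cuts hopeless searches. *)
Fixpoint find_pairs (vs : seq (seq bool)) (F : seq edge3) :
    option (seq (edge3 * edge3)) :=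
  if size F < (size vs).*2 then None else
  if vs is v :: vs' then
    let I := [seq c <- F | incident v c] in
    foldr (fun a acc => foldr (fun b acc' =>
        if acc' is Some P then Some P else if a == b then None else
        if find_pairs vs' [seq c <- F | (c != a) && (c != b)] is Some P
        then Some ((a, b) :: P) else None) acc I) None I
  else Some (pair_up F).

Definition fresh (B : seq edge3) (v : seq bool) : bool := ~~ has (incident v) B.

(* Searching only among the edges with two untouched ends is enough for Breaker
   to win. Quantifiers are spelt with [find] and conjunctions with [if]: unlike
   [all], [has] and [&&], these stop early under call-by-value evaluation. *)
Fixpoint breaker_wins (n : nat) (M B : seq edge3) : bool :=
  let F := unclaimed M B in
  if find_pairs [seq v <- cube3_vertices | fresh B v] F is Some P
  then pairs_off M B P
  else if n is n'.+1 then
    let can_answer m :=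
      let G := [seq b <- F | (b != m) && (fresh B b.1 && fresh B b.2)] in
      find (fun b => breaker_wins n' (m :: M) (b :: B)) G < size G in
    if size F <= find (fun m => ~~ can_answer m) F then ~~ nilp F else false
  else false.

Lemma breaker_wins_safe n M B : breaker_wins n M B -> safe M B.
Proof.
elim: n M B => [|n IH] M B /=; case: find_pairs => [P|] //;
  try by move/SafePairs.
case: ifP => // le_F F0.
apply: SafeAnswer => // m mF; move: le_F.
(* [find] runs to the end of [F] exactly when every Maker move can be answered. *)
rewrite leqNgt -has_find -all_predC => /allP/(_ m mF) /=; rewrite negbK.
rewrite -has_find => /hasP[b]; rewrite mem_filter => /andP[/andP[bm _] bF] /IH sb.
exists b => //; move: bF.
by rewrite /unclaimed !mem_filter inE negb_or (negbTE bm).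
Qed.

Lemma cube3_safe : safe [::] [::].
Proof. by apply: (@breaker_wins_safe 3); vm_compute. Qed.

(** * Vertices, edges and directions of [Q_d] *)

Section Hypercube.
Variable d : nat.
Local Notation vertex := {ffun 'I_d -> bool}.
Implicit Types (x y a : vertex) (i : 'I_d) (k j : nat) (v w : seq bool).
Implicit Types (c : edge3) (f m : {set vertex}) (M B : {set {set vertex}}).

Definition flip x i : vertex := [ffun i' => x i' (+) (i' == i)].
Definition edge x i : {set vertex} := [set x; flip x i].

Lemma edge_hypercube x i : edge x i \in edges (@hypercube d).
Proof.
apply/imsetP; exists (x, flip x i) => //; rewrite inE /=.
rewrite /hypercube (_ : [set _ | _] = [set i]) ?cards1 //.
by apply/setP=> i'; rewrite !inE ffunE; case: (x i'); case: (i' == i).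
Qed.

Lemma hypercube_edgeP f : f \in edges (@hypercube d) -> exists x i, f = edge x i.
Proof.
case/imsetP=> -[x y]; rewrite inE /= => /cards1P[i xy ->]; exists x, i.
congr [set _; _]; apply/ffunP=> i'; rewrite ffunE.
by have /setP/(_ i') := xy; rewrite !inE => <-; case: (x i'); case: (y i').
Qed.

Lemma edge_eq_off x i y z i' :
  y \in edge x i -> z \in edge x i -> i' != i -> y i' = z i'.
Proof.
by move=> + + /negbTE ii'; rewrite !inE => /orP[]/eqP-> /orP[]/eqP->;
  rewrite ?ffunE ?ii' ?addbF.
Qed.

Lemma edge_dir_inj x i y i' : edge x i = edge y i' -> i = i'.
Proof.
move=> E; apply/eqP/negPn/negP=> ii'.
have: x i = flip x i i.
  by apply: (edge_eq_off (x := y)) ii'; rewrite -E !inE eqxx ?orbT.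
by rewrite ffunE eqxx; case: (x i).
Qed.

(** * The copies of [Q_3] inside [Q_d] *)

Definition subst a k v : vertex :=
  [ffun i : 'I_d => if i %/ 3 == k then nth false v (i %% 3) else a i].

(* The default [false] is never used when [k < d %/ 3]. *)
Definition bits x k : seq bool :=
  mkseq (fun j => if insub (k * 3 + j) is Some i then x i else false) 3.

(** The edge [c] in the copy through [a] with directions [3k], [3k+1], [3k+2]. Changing [a] inside
    this triple of coordinates names the same copy. *)
Definition block_edge a k c : {set vertex} := [set subst a k c.1; subst a k c.2].

Lemma subst_bits x k : subst x k (bits x k) = x.
Proof.
apply/ffunP=> i; rewrite ffunE; case: eqP => // <-.
by rewrite nth_mkseq ?ltn_pmod // -divn_eq valK.
Qed.

Lemma coordP k j : k < d %/ 3 -> j < 3 ->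
  exists i : 'I_d, i %/ 3 = k /\ i %% 3 = j.
Proof.
move=> kd j3; have lt : k * 3 + j < d.
  rewrite (leq_trans _ (leq_trunc_div d 3)) // (@leq_trans (k.+1 * 3)) //.
    by rewrite mulSn addnC ltn_add2r.
  by rewrite leq_pmul2r.
exists (Ordinal lt).
by rewrite /= divnMDl // modnMDl divn_small // modn_small // addn0.
Qed.

Lemma subst_flip_bit a i v :
  subst a (i %/ 3) (flip_bit v (i %% 3)) = flip (subst a (i %/ 3) v) i.
Proof.
apply/ffunP=> i'; rewrite !ffunE /flip_bit nth_set_nth /=.
have -> : (i' == i) = (i' %/ 3 == i %/ 3) && (i' %% 3 == i %% 3).
  apply/eqP/andP=> [->//|[/eqP q /eqP r]].
  by apply/val_inj; rewrite /= (divn_eq i' 3) q r -divn_eq.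
case: eqP => [_|_] /=; last by rewrite addbF.
by case: eqP => [->|_]; rewrite ?addbT ?addbF.
Qed.

Lemma cube3_edgesP c : c \in cube3_edges ->
  exists2 j, j < 3 & c.2 = flip_bit c.1 j.
Proof.
case/allpairsPdep=> v [j [_]]; rewrite mem_filter => /andP[_ j3] ->.
by exists j => //; move: j3; rewrite !inE => /or3P[] /eqP->.
Qed.

Lemma size_cube3_edges c : c \in cube3_edges -> size c.1 = 3 /\ size c.2 = 3.
Proof.
have /allP all3 :
  all (fun c => (size c.1 == 3) && (size c.2 == 3)) cube3_edges by [].
by move/all3/andP=> [/eqP-> /eqP->].
Qed.

Lemma mem_cube3_vertices v : size v = 3 -> v \in cube3_vertices.
Proof. by case: v => [|[] [|[] [|[] []]]]. Qed.

Lemma mem_cube3_edges v j : size v = 3 -> j < 3 ->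
  ((v, flip_bit v j) \in cube3_edges) || ((flip_bit v j, v) \in cube3_edges).
Proof.
have /allP all3 : all (fun v => all (fun j => ((v, flip_bit v j) \in cube3_edges)
  || ((flip_bit v j, v) \in cube3_edges)) (iota 0 3)) cube3_vertices by [].
move=> /mem_cube3_vertices/all3 /allP + j3; apply.
by rewrite mem_iota.
Qed.

Lemma block_edge_dir a k c : k < d %/ 3 -> c \in cube3_edges ->
  exists2 i : 'I_d, i %/ 3 = k & block_edge a k c = edge (subst a k c.1) i.
Proof.
move=> kd /cube3_edgesP[j j3 cj]; have [i [ik ij]] := coordP kd j3.
by exists i => //; rewrite /block_edge cj -ik -ij subst_flip_bit.
Qed.

Lemma edge_block x i : i %/ 3 < d %/ 3 ->
  exists2 c, c \in cube3_edges & edge x i = block_edge x (i %/ 3) c.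
Proof.
move=> id; pose v := bits x (i %/ 3).
have xv : subst x (i %/ 3) v = x := subst_bits _ _.
have xw : subst x (i %/ 3) (flip_bit v (i %% 3)) = flip x i.
  by rewrite subst_flip_bit xv.
have sv : size v = 3 by rewrite size_mkseq.
case/orP: (mem_cube3_edges sv (ltn_pmod i (isT : 0 < 3))) => vE;
  [exists (v, flip_bit v (i %% 3)) | exists (flip_bit v (i %% 3), v)] => //;
  by rewrite /block_edge /= xv xw // setUC.
Qed.

Lemma subst_inj a k v w : k < d %/ 3 -> size v = 3 -> size w = 3 ->
  subst a k v = subst a k w -> v = w.
Proof.
move=> kd sv sw E; apply: (@eq_from_nth _ false); rewrite sv ?sw // => j j3.
have [i [ik ij]] := coordP kd j3.
by have /ffunP/(_ i) := E; rewrite !ffunE ik eqxx ij.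
Qed.

Lemma block_edge_inj a k : k < d %/ 3 ->
  {in cube3_edges &, injective (block_edge a k)}.
Proof.
move=> kd c c' cE cE' E.
have [s1 s2] := size_cube3_edges cE; have [s1' s2'] := size_cube3_edges cE'.
(* Of two distinct edges of [Q_3], the first has an end that is not an end of the second; all pairs
   are checked. *)
have /allP/(_ c cE)/allP/(_ c' cE') : all (fun c => all (fun c' =>
  [|| c == c', (c.1 != c'.1) && (c.1 != c'.2) | (c.2 != c'.1) && (c.2 != c'.2)])
  cube3_edges) cube3_edges by vm_compute.
have inj v w := @subst_inj a k v w kd.
case/or3P=> [/eqP//|/andP[n1 n2]|/andP[n1 n2]].
  have : subst a k c.1 \in block_edge a k c' by rewrite -E !inE eqxx.
  by rewrite !inE => /orP[]/eqP/inj e; rewrite e ?eqxx in n1 n2.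
have : subst a k c.2 \in block_edge a k c' by rewrite -E !inE eqxx orbT.
by rewrite !inE => /orP[]/eqP/inj e; rewrite e ?eqxx in n1 n2.
Qed.

(** The direction of the common edge determines the triple, and its ends determine all coordinates
    outside the triple. *)
Lemma block_edge_disjoint a k c a' k' c' : k < d %/ 3 -> k' < d %/ 3 ->
  c \in cube3_edges -> c' \in cube3_edges ->
  block_edge a k c = block_edge a' k' c' -> k = k' /\ subst a k =1 subst a' k.
Proof.
move=> kd kd' cE cE' E.
have [i ik Ei] := block_edge_dir a kd cE.
have [i' ik' Ei'] := block_edge_dir a' kd' cE'.
have ii' : i = i'.
  apply: (@edge_dir_inj (subst a k c.1) _ (subst a' k' c'.1)).
  by rewrite -Ei -Ei'.
have kk' : k = k' by rewrite -ik -ik' ii'.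
split=> // v; apply/ffunP=> p; rewrite !ffunE; case: eqP => // pk.
have : subst a k c.1 p = subst a' k' c'.1 p.
  apply: (@edge_eq_off (subst a k c.1) i).
  - by rewrite !inE eqxx.
  - by rewrite -Ei E !inE eqxx.
  - by apply/eqP=> pi; rewrite pi ik in pk.
by rewrite !ffunE -kk'; case: eqP.
Qed.

(** * Leftover directions and the mirror pairing *)

Definition leftover f : bool :=
  [forall x in f, forall y in f, forall i : 'I_d,
    (i %/ 3 < d %/ 3) ==> (x i == y i)].

Lemma leftover_edge x i : leftover (edge x i) = (d %/ 3 <= i %/ 3).
Proof.
apply/idP/idP=> [/forall_inP/(_ x)|le_i].
  rewrite !inE eqxx => /(_ isT)/forall_inP/(_ (flip x i)).
  rewrite !inE eqxx orbT => /(_ isT)/forallP/(_ i).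
  by rewrite ffunE eqxx leqNgt; case: ltnP => //= _; case: (x i).
apply/forall_inP=> y ye; apply/forall_inP=> z ze; apply/forallP=> i'.
apply/implyP=> lt_i'; apply/eqP; apply: edge_eq_off ye ze _.
by apply: contraTneq lt_i' => ->; rewrite -leqNgt.
Qed.

Lemma leftover_block a k c : k < d %/ 3 -> c \in cube3_edges ->
  ~~ leftover (block_edge a k c).
Proof.
move=> kd cE; have [i ik ->] := block_edge_dir a kd cE.
by rewrite leftover_edge ik -ltnNge.
Qed.

Definition mirror i f : {set vertex} := [set flip x i | x in f].

Lemma flipK i : involutive (flip^~ i).
Proof. by move=> x; apply/ffunP=> i'; rewrite !ffunE addbK. Qed.

Lemma mirror_edge i x i' : mirror i (edge x i') = edge (flip x i) i'.
Proof.
rewrite /mirror /edge imsetU1 imset_set1; congr [set _; _].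
by apply/ffunP=> p; rewrite !ffunE addbAC.
Qed.

Lemma mirrorK i f : f \in edges (@hypercube d) -> mirror i (mirror i f) = f.
Proof. by case/hypercube_edgeP=> x [i' ->]; rewrite !mirror_edge flipK. Qed.

Lemma mirror_neq i x i' : i' != i -> mirror i (edge x i') != edge x i'.
Proof.
move=> ii'; rewrite mirror_edge; apply/eqP=> E.
have fx : flip x i \in edge x i' by rewrite -E !inE eqxx.
have xx : x \in edge x i' by rewrite !inE eqxx.
rewrite eq_sym in ii'; have := edge_eq_off fx xx ii'.
by rewrite ffunE eqxx; case: (x i).
Qed.

(** * The invariant on [Q_d] and the resulting degree *)

Definition block_safe M B a k : Prop :=
  exists lM lB, [/\ safe lM lB, {subset lB <= cube3_edges} &
    {in cube3_edges, forall c, ((block_edge a k c \in M) = (c \in lM)) /\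
                               ((block_edge a k c \in B) = (c \in lB))}].

(** For a leftover edge it only matters whether it is claimed, not by whom: these edges merely give
    Breaker a legal answer. *)
Definition board_safe i0 M B : Prop :=
  (forall a k, k < d %/ 3 -> block_safe M B a k) /\
  {in edges (@hypercube d), forall f, leftover f ->
     (mirror i0 f \in M :|: B) = (f \in M :|: B)}.

Lemma board_safe0 i0 : board_safe i0 set0 set0.
Proof.
split=> [a k kd|f _ _]; last by rewrite !inE.
exists [::], [::]; split=> //; first exact: cube3_safe.
by move=> c _; rewrite !inE.
Qed.

Lemma block_safe_off M B m b a k :
  {in cube3_edges, forall c, block_edge a k c != m /\ block_edge a k c != b} ->
  block_safe M B a k -> block_safe (m |: M) (b |: B) a k.
Proof.
move=> off [lM [lB [sl lB3 lE]]]; exists lM, lB; split=> // c cE.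
have [/negbTE cm /negbTE cb] := off c cE; have [<- <-] := lE c cE.
by rewrite !inE cm cb.
Qed.

Lemma unclaimed_block M B lM lB a k c :
  {in cube3_edges, forall c, ((block_edge a k c \in M) = (c \in lM)) /\
                             ((block_edge a k c \in B) = (c \in lB))} ->
  c \in cube3_edges ->
  (c \in unclaimed lM lB) = (block_edge a k c \notin M :|: B).
Proof.
by move=> lE cE; rewrite mem_filter cE andbT mem_cat in_setU;
  have [-> ->] := lE c cE.
Qed.

(** This is [safe_answer] carried over by [block_edge x k], which is injective on the edges of
    [Q_3]. *)
Lemma block_answer M B x k c : k < d %/ 3 -> c \in cube3_edges ->
  block_safe M B x k -> block_edge x k c \notin M :|: B ->
  exists2 c', c' \in cube3_edges &
    block_edge x k c' \notin block_edge x k c |: (M :|: B) /\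
    block_safe (block_edge x k c |: M) (block_edge x k c' |: B) x k.
Proof.
move=> kd cE [lM [lB [sl lB3 lE]]] mF.
have [b bF sb] : exists2 b, b \in unclaimed (c :: lM) lB &
                            safe (c :: lM) (b :: lB).
  by apply: safe_answer sl _; rewrite (unclaimed_block lE).
have bE : b \in cube3_edges by move: bF; rewrite mem_filter => /andP[].
have inj c1 c2 : c1 \in cube3_edges -> c2 \in cube3_edges ->
    (block_edge x k c1 == block_edge x k c2) = (c1 == c2).
  by move=> E1 E2; apply/eqP/eqP=> [|->//]; apply: block_edge_inj.
have lmE : {in cube3_edges, forall c',
    ((block_edge x k c' \in block_edge x k c |: M) = (c' \in c :: lM)) /\
    ((block_edge x k c' \in B) = (c' \in lB))}.
  by move=> c' c'E; have [e1 e2] := lE c' c'E; rewrite in_setU1 inj // e1 e2 inE.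
exists b => //; split; first by rewrite setUA -(unclaimed_block lmE).
exists (c :: lM), (b :: lB); split=> // [c'|c' c'E].
  by rewrite inE => /predU1P[->|/lB3].
by have [-> e2] := lmE c' c'E; rewrite in_setU1 inj // e2 inE.
Qed.

Lemma board_safe_maintains i0 : i0 %/ 3 < d %/ 3 ->
  maintains (@hypercube d) (board_safe i0).
Proof.
move=> i0d M B m [sMB mir] mE mF; have [x [i mxi]] := hypercube_edgeP mE.
have [id|le_i] := ltnP (i %/ 3) (d %/ 3); last first.
  have ml : leftover m by rewrite mxi leftover_edge.
  have ml' : leftover (mirror i0 m) by rewrite mxi mirror_edge leftover_edge.
  have mm' : mirror i0 m != m.
    (* The direction [i0] lies in a full triple and that of [m] does not, so they differ. *)
    by rewrite mxi mirror_neq //; apply: contraTneq i0d => <-; rewrite -leqNgt.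
  exists (mirror i0 m); split.
  - by rewrite mxi mirror_edge edge_hypercube.
  - by rewrite in_setU1 negb_or mm' mir.
  split=> [a k kd|f fE fl].
    apply: block_safe_off (sMB a k kd) => c cE.
    by split; apply: contraNneq (leftover_block a kd cE) => ->.
  (* As [mirror i0] is an involution, [mirror i0 f] is one of the two new edges exactly when [f]
     is. *)
  have swap g h : g \in edges (@hypercube d) -> h \in edges (@hypercube d) ->
      (mirror i0 g == h) = (g == mirror i0 h).
    move=> gE hE; apply/eqP/eqP=> [<-|->]; by rewrite mirrorK.
  have m'E : mirror i0 m \in edges (@hypercube d).
    by rewrite mxi mirror_edge edge_hypercube.
  have := mir f fE fl; rewrite !inE !swap // mirrorK //.
  by case: (f == m) => //; case: (f == mirror i0 m); rewrite ?orbT.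
have [c cE mc] := edge_block x id; rewrite -mxi in mc.
have [|c' c'E [bF sb]] := block_answer id cE (sMB x _ id); first by rewrite -mc.
exists (block_edge x (i %/ 3) c'); rewrite mc; split=> //.
  by have [i' _ ->] := block_edge_dir x id c'E; apply: edge_hypercube.
split=> [a k kd|f fE fl].
  (* Either [a] and [k] name the copy just played in, or their copy contains neither of the new
     edges. *)
  have [[kE aE]|ne] := pselect (k = i %/ 3 /\ subst a k =1 subst x k).
    case: sb => lM [lB [sl lB3 lE]]; exists lM, lB; split=> // e eE.
    by rewrite /block_edge !aE kE; apply: lE.
  apply: block_safe_off (sMB a k kd) => e eE.
  by split; apply/eqP=> /(block_edge_disjoint kd id eE) d1; apply: ne;
    apply: d1.
have fl' : leftover (mirror i0 f).
  move: fl; have [y [j ->]] := hypercube_edgeP fE.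
  by rewrite mirror_edge !leftover_edge.
have off g e : leftover g -> e \in cube3_edges ->
    (g == block_edge x (i %/ 3) e) = false.
  move=> gl eE; apply/negbTE; apply: contraTneq gl => ->.
  exact: leftover_block.
have := mir f fE fl.
by rewrite !in_setU !in_set1 !off.
Qed.

Lemma board_safe_degree i0 M B x : board_safe i0 M B ->
  edges (@hypercube d) \subset M :|: B ->
  d %/ 3 <= #|[set f in B | x \in f]|.
Proof.
move=> [sMB _] /subsetP full.
have star (k : 'I_(d %/ 3)) : exists c, [/\ c \in cube3_edges,
    block_edge x k c \in B & x \in block_edge x k c].
  have [lM [lB [sl lB3 lE]]] := sMB x k (ltn_ord k).
  have F0 : unclaimed lM lB = [::].
    apply/eqP; rewrite -[_ == _]negbK -has_filter; apply/hasPn=> c cE.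
    have := unclaimed_block lE cE; rewrite mem_filter cE andbT => ->.
    have [i _ ->] := block_edge_dir x (ltn_ord k) cE.
    by rewrite negbK full // edge_hypercube.
  (* [bits x k] is the vertex of [Q_3] that [x] occupies in its own copy. By [lB3], the entry of
     [lB] found there is a genuine edge of [Q_3]. *)
  have := safe_end sl F0 (mem_cube3_vertices (size_mkseq _ 3 : size (bits x k) = 3)).
  case/hasP=> c /[dup] /lB3 cE clB cv; exists c; split=> //.
    by have [_ ->] := lE c cE.
  rewrite -{1}(subst_bits x k) in_set2.
  by case/orP: cv => /eqP ->; rewrite eqxx ?orbT.
have [c_ cP] := choice star.
pose f_ (k : 'I_(d %/ 3)) := block_edge x k (c_ k).
(* Edges chosen for different triples have different directions, hence they count separately. *)
have f_inj : injective f_.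
  move=> k k' E; apply/val_inj.
  have [kE _ _] := cP k; have [kE' _ _] := cP k'.
  by have [] := block_edge_disjoint (ltn_ord k) (ltn_ord k') kE kE' E.
rewrite -[leqLHS]card_ord -(card_imset _ f_inj).
apply/subset_leq_card/subsetP=> _ /imsetP[k _ ->].
by have [_ cB cx] := cP k; rewrite inE cB.
Qed.

End Hypercube.

Theorem theorem1 (d : nat) (hd : 1 <= d) :
  breaker_secures (@hypercube d) (d %/ 3) /\ d %/ 3 <= deltaB (@hypercube d).
Proof.
suff bs : breaker_secures (@hypercube d) (d %/ 3).
  by split=> //; apply/(leq_deltaB _ [ffun=> false]).
(* If there is no full triple the bound is 0, and [leq_deltaB] turns [0 <= deltaB] into a
   strategy. *)
have [d0|d3] := posnP (d %/ 3).
  by apply/(leq_deltaB _ [ffun=> false]); rewrite d0.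
(* The mirror direction is coordinate 0, which lies in the first full triple. *)
have i0d : Ordinal hd %/ 3 < d %/ 3 by rewrite div0n.
apply: (invariant_secures (board_safe0 _) (board_safe_maintains i0d)).
by move=> M B sMB full x; apply: board_safe_degree sMB full.
Qed.
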